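(* For $k=0,\dots,3$, let $\Lambda^k_h$ be a finite-dimensional subspace of $H\Lambda^k$ with $d\Lambda^k_h\subset\Lambda^{k+1}_h$, and suppose there exist projections $\Pi_h=\Pi^k_h:\Lambda^k\to\Lambda^k_h$ which commute with $d$, i.e. such that $d\,\Pi^k_h=\Pi^{k+1}_h\,d$ for $k=0,1,2$. Let $\tilde\Lambda^k_h$, $k=0,\dots,3$, be a second set of finite-dimensional spaces with corresponding projections $\tilde\Pi^k_h$ having the same properties. Assume $\mathcal{P}_1(\Omega)\subset\Lambda^0_h$ and $\mathcal{P}_1(\Omega)\subset\tilde\Lambda^0_h$. If the operator $$S_{1,h}:=d\,\Pi^1_hK-\Pi^2_hK\,d$$ maps $\tilde\Lambda^1_h(\mathbb{V})$ onto $\Lambda^2_h(\mathbb{K})$, and if both discrete de Rham sequences $$\mathbb{R}\hookrightarrow\Lambda^0_h\xrightarrow{d}\Lambda^1_h\xrightarrow{d}\Lambda^2_h\xrightarrow{d}\Lambda^3_h\to0,\qquad \mathbb{R}\hookrightarrow\tilde\Lambda^0_h\xrightarrow{d}\tilde\Lambda^1_h\xrightarrow{d}\tilde\Lambda^2_h\xrightarrow{d}\tilde\Lambda^3_h\to0$$ are exact, then the discrete elasticity sequence $$\Phi(\mathbb{W})\hookrightarrow\Lambda^0_h(\mathbb{W})\xrightarrow{\mathcal{A}_h}\Gamma^1_h\xrightarrow{\mathcal{A}_h}\Gamma^2_h\xrightarrow{\mathcal{A}_h}\Lambda^3_h(\mathbb{W})\to0$$ is also exact.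
   Context: $\Omega\subset\mathbb{R}^3$ is a domain; $\mathbb{V}=\mathbb{R}^3$; $\mathbb{K}$ is the space of real skew-symmetric $3\times3$ matrices; $\mathbb{W}=\mathbb{K}\times\mathbb{V}$; $\operatorname{skw}M=\frac12(M-M^T)$. $\Lambda^k$ is the space of smooth differential $k$-forms on $\Omega$, $d$ the exterior derivative, and $H\Lambda^k=\{\omega\in L^2\Lambda^k(\Omega): d\omega\in L^2\Lambda^{k+1}(\Omega)\}$. $\mathcal{P}_1(\Omega)$ is the space of polynomials of degree $\le1$ (viewed as $0$-forms). For a vector space $\mathbb{X}$, $\Lambda^k(\mathbb{X})$, $\Lambda^k_h(\mathbb{X})$, $\tilde\Lambda^k_h(\mathbb{X})$ are the $\mathbb{X}$-valued analogues; $d$, $\Pi_h$, $\tilde\Pi_h$ act on them componentwise. The operator $K$ takes $\mathbb{V}$-valued $k$-forms to $\mathbb{K}$-valued $k$-forms: $(K\omega)_x(v_1,\dots,v_k)=K_x[\omega_x(v_1,\dots,v_k)]$, where $K_xv=2\operatorname{skw}(xv^T)$. Convention: a projection $\Pi_h$ maps smooth forms onto $\Lambda^k_h$, is defined also on $\Lambda^k_h$ where it is the identity, and $\Pi_h^k$ (for $\mathbb{K}$-valued forms) is defined on $K\tilde\Lambda^k_h(\mathbb{V})$, so that the following operators make sense. Write $\Lambda^k_h(\mathbb{W}):=\Lambda^k_h(\mathbb{K})\times\tilde\Lambda^k_h(\mathbb{V})$. Set - $K_h=\Pi_hK:\tilde\Lambda^k_h(\mathbb{V})\to\Lambda^k_h(\mathbb{K})$;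 - $S_h=S_{k,h}=dK_h-K_hd:\tilde\Lambda^k_h(\mathbb{V})\to\Lambda^{k+1}_h(\mathbb{K})$, $k=0,1,2$; - $\mathcal{A}_h:\Lambda^k_h(\mathbb{W})\to\Lambda^{k+1}_h(\mathbb{W})$, $\mathcal{A}_h(\omega,\mu)=(d\omega-S_h\mu,\,d\mu)$ (equivalently $\mathcal{A}_h=\Phi_hd\Phi_h^{-1}$ with $\Phi_h(\omega,\mu)=(\omega+K_h\mu,\mu)$); - $\Phi(\mathbb{W})=\{(\omega+K\mu,\mu):(\omega,\mu)\in\mathbb{K}\times\mathbb{V}\}$, where elements of $\mathbb{K}$ and $\mathbb{V}$ are regarded as constant $0$-forms; - $\Gamma^1_h=\{(\omega,\mu)\in\Lambda^1_h(\mathbb{W}): d\omega=S_{1,h}\mu\}$; - $\Gamma^2_h=\{(\omega,\mu)\in\Lambda^2_h(\mathbb{W}):\omega=0\}$. Exactness means that the image (or the included subspace, at the first place) equals the kernel of the next map at every place, including surjectivity onto the last space. *)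

(* Defs.v *)
From HB Require Import structures.
From mathcomp Require Import all_boot all_order all_algebra.
From mathcomp Require Import generic_quotient ring_quotient.
From mathcomp Require Import all_classical all_reals all_analysis.

Set Implicit Arguments.
Unset Strict Implicit.
Unset Printing Implicit Defensive.

Import Order.TTheory GRing.Theory Num.Theory.
Import numFieldNormedType.Exports.

Local Open Scope classical_set_scope.
Local Open Scope ring_scope.
Local Open Scope quotient_scope.

(* Points of R^3.  measurableTypeR R is convertible to R; it carries both the
   Borel structure used by lebesgue_measure and the norm of R. *)
Notation pt R :=
  (measurableTypeR R * measurableTypeR R * measurableTypeR R)%type.

Definition leb3 (R : realType) : {measure set (pt R) -> \bar R} :=
  ((@lebesgue_measure R) \x (@lebesgue_measure R) \x (@lebesgue_measure R))%E.

Section Calculus.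
Variable R : realType.
Implicit Types (Om : set (pt R)) (f phi : pt R -> R).

Definition domain3 Om : Prop := [/\ open Om, connected Om & Om !=set0].

Definition vec (x : pt R) : 'cV[R]_3 :=
  \col_i tnth [tuple (x.1.1 : R); (x.1.2 : R); (x.2 : R)] i.

Definition basis3 (j : 'I_3) : pt R :=
  ((j == 0 :> nat)%:R, (j == 1 :> nat)%:R, (j == 2 :> nat)%:R).

Definition partial (j : 'I_3) f : pt R -> R := fun x => 'D_(basis3 j) f x.

(* f is C^oo on the open set Om: all iterated partial derivatives exist and are
   continuous at every point of Om; the values of f outside Om are irrelevant *)
Definition smooth_on Om f : Prop :=
  forall (s : seq 'I_3) (x : pt R), Om x ->
    {for x, continuous (foldr partial f s)} /\
    forall j, derivable (foldr partial f s) x (basis3 j).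

Definition test_function Om phi : Prop :=
  let supp := closure [set x | phi x != 0] in
  [/\ smooth_on setT phi, compact supp & supp `<=` Om].

Definition square_integrable Om f : Prop :=
  measurable_fun Om f /\ (\int[@leb3 R]_(x in Om) (f x ^+ 2)%:E < +oo)%E.

End Calculus.

(* Real functions modulo equality almost everywhere on Om. *)
Section AeClasses.
Variable R : realType.
Variable Om : set (pt R).

Definition ae_zero : {pred pt R -> R} :=
  fun f => `[< f = cst 0 %[ae @leb3 R in Om] >].

Lemma ae_zero_submod : submod_closed ae_zero.
Proof.
split; first exact/asboolP/ae_eq_refl.
move=> a f g /asboolP f0 /asboolP g0; apply/asboolP.
move: f0 g0; apply: filterS2 => x f0 g0 Omx.
have -> : (a *: f + g) x = a * f x + g x by [].
by rewrite f0// g0//= mulr0 addr0.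
Qed.

HB.instance Definition _ :=
  GRing.isSubmodClosed.Build R (pt R -> R) ae_zero ae_zero_submod.

Definition L0 : Type := {ideal_quot (ae_zero : zmodClosed _)}.
HB.instance Definition _ := Choice.on L0.
HB.instance Definition _ := EqQuotient.on L0.
HB.instance Definition _ := GRing.Zmodule.on L0.

Definition cls (f : pt R -> R) : L0 := \pi_L0 f.

Lemma clsP f g : cls f = cls g <-> f = g %[ae @leb3 R in Om].
Proof.
have -> : cls f = cls g <-> f - g \in ae_zero.
  by rewrite Quotient.idealrBE; split => [/eqP|/eqP].
split=> [/asboolP fg|fg]; last apply/asboolP; move: fg; apply: filterS => x fg Omx.
  by apply/eqP; rewrite -subr_eq0; apply/eqP/fg.
have -> : (f - g) x = f x - g x by [].
by rewrite fg// subrr.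
Qed.

Lemma clsK (w : L0) : cls (repr w) = w.
Proof. exact: reprK. Qed.

Lemma repr_cls f : repr (cls f) = f %[ae @leb3 R in Om].
Proof. by apply/clsP; rewrite clsK. Qed.

Lemma clsD f g : cls (f + g) = cls f + cls g.
Proof. exact: (raddfD \pi_{ideal_quot (ae_zero : zmodClosed _)}). Qed.

Definition scaleL0 (a : R) (w : L0) : L0 := cls (a *: repr w).

Lemma cls_scale a f : scaleL0 a (cls f) = cls (a *: f).
Proof.
apply/clsP; have := repr_cls f; apply: filterS => x fx Omx.
by rewrite /GRing.scale/= fx.
Qed.

Lemma scaleL0A a b w : scaleL0 a (scaleL0 b w) = scaleL0 (a * b) w.
Proof. by rewrite -[w]clsK !cls_scale scalerA. Qed.

Lemma scaleL01 : left_id 1 scaleL0.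
Proof. by move=> w; rewrite -[w]clsK cls_scale scale1r. Qed.

Lemma scaleL0Dr : right_distributive scaleL0 +%R.
Proof.
by move=> a v w; rewrite -[v]clsK -[w]clsK -clsD !cls_scale scalerDr clsD.
Qed.

Lemma scaleL0Dl w : {morph scaleL0^~ w : a b / a + b}.
Proof. by move=> a b; rewrite -[w]clsK !cls_scale scalerDl clsD. Qed.

HB.instance Definition _ := GRing.Zmodule_isLmodule.Build R L0
  scaleL0A scaleL01 scaleL0Dr scaleL0Dl.

End AeClasses.

(* A k-form omega = sum_I omega_I dx_I is given by its components omega_I on the
   basis dx_I = dx_i1 /\ ... /\ dx_ik, where I = {i1 < ... < ik}. *)
Definition idx (k : nat) : Type := {I : {set 'I_3} | #|I| == k}.
HB.instance Definition _ k := Finite.on (idx k).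

Section Forms.
Variable R : realType.

Definition pform (k : nat) : Type := idx k -> pt R -> R.

Definition pcoef k (w : pform k) (I : {set 'I_3}) : pt R -> R :=
  oapp w (fun=> 0) (insub I).

(* the sign in dx_j /\ dx_(J \ j) = dsign j J * dx_J *)
Definition dsign (j : 'I_3) (J : {set 'I_3}) : R :=
  (-1) ^+ #|[set i in J | (i < j)%N]|.

Definition ext_d k (w : pform k) : pform k.+1 := fun J x =>
  \sum_(j in val J) dsign j (val J) * partial j (pcoef w (val J :\ j)) x.

Variable Om : set (pt R).

Definition weak_ext_d k (f : pform k) (g : pform k.+1) : Prop :=
  forall phi, test_function Om phi -> forall J : idx k.+1,
    \int[@leb3 R]_(x in Om) (g J x * phi x) =
    - \sum_(j in val J) dsign j (val J) *
        \int[@leb3 R]_(x in Om) (pcoef f (val J :\ j) x * partial j phi x).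

Definition kform (k : nat) : Type := {ffun idx k -> L0 Om}.
HB.instance Definition _ k := GRing.Lmodule.on (kform k).

Definition to_form k (w : pform k) : kform k := [ffun I => cls Om (w I)].

Definition smooth_form k (w : pform k) : Prop :=
  forall I, smooth_on Om (w I).

Definition L2_form k (w : pform k) : Prop :=
  forall I, square_integrable Om (w I).

Definition is_d k (w : kform k) (e : kform k.+1) : Prop :=
  exists (f : pform k) (g : pform k.+1),
    [/\ L2_form f, L2_form g, w = to_form f, e = to_form g & weak_ext_d f g].

Definition HLambda k : set (kform k) := [set w | exists e, is_d w e].

(* The exterior derivative on HLambda (junk value 0 elsewhere): weak derivatives
   are unique in L^2, so the choice made by xget is immaterial. *)
Definition dform k (w : kform k) : kform k.+1 := xget 0 (is_d w).

Definition const0 (c : R) : kform 0 := to_form (fun _ _ => c).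

Definition constants : set (kform 0) := range const0.

Definition P1 : set (kform 0) :=
  [set w | exists (c : R) (a : 'rV[R]_3),
     w = to_form (fun _ x => c + (a *m vec x) 0 0)].

End Forms.

Arguments kform {R} Om k.
Arguments to_form {R} Om {k} w.
Arguments smooth_form {R} Om {k} w.
Arguments HLambda {R} Om k.
Arguments dform {R Om k} w.
Arguments const0 {R} Om c.
Arguments constants {R} Om.
Arguments P1 {R} Om.

(* 0 -> C -> A0 -f0-> A1 -f1-> A2 -f2-> A3 -> 0 is exact, C being included in A0
   and fi being considered on Ai only. *)
Definition exact_sequence (V0 V1 V2 V3 : zmodType)
    (C A0 : set V0) (A1 : set V1) (A2 : set V2) (A3 : set V3)
    (f0 : V0 -> V1) (f1 : V1 -> V2) (f2 : V2 -> V3) : Prop :=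
  [/\ C = A0 `&` [set v | f0 v = 0],
      f0 @` A0 = A1 `&` [set v | f1 v = 0],
      f1 @` A1 = A2 `&` [set v | f2 v = 0]
    & f2 @` A2 = A3].

Section DiscreteSpaces.
Variables (R : realType) (Om : set (pt R)).
Implicit Types (L D : forall k, set (kform Om k))
  (Pi : forall k, kform Om k -> kform Om k).

Definition findim_subspace (V : lmodType R) (A : set V) : Prop :=
  exists (n : nat) (b : 'I_n -> V),
    A = [set v | exists c : 'I_n -> R, v = \sum_i c i *: b i].

Definition lin_subspace (V : lmodType R) (A : set V) : Prop :=
  A 0 /\ forall (a : R) (u v : V), A u -> A v -> A (a *: u + v).

(* (L^k), k = 0..3: finite-dimensional subspaces of HLambda^k, stable under d *)
Definition discrete_spaces L : Prop :=
  [/\ forall k, (k <= 3)%N -> findim_subspace (L k),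
      forall k, (k <= 3)%N -> L k `<=` HLambda Om k
    & forall k, (k < 3)%N -> dform @` L k `<=` L k.+1].

(* Pi^k is a linear map defined on the space D^k, which contains both the smooth
   forms and L^k; its values outside D^k are irrelevant. *)
Record projections L D Pi : Prop := {
  proj_dom : forall k, (k <= 3)%N -> lin_subspace (D k);
  proj_dom_smooth : forall k, (k <= 3)%N ->
    forall w : pform R k, smooth_form Om w -> D k (to_form Om w);
  proj_dom_discrete : forall k, (k <= 3)%N -> L k `<=` D k;
  proj_linear : forall k, (k <= 3)%N -> forall (a : R) (u v : kform Om k),
    D k u -> D k v -> Pi k (a *: u + v) = a *: Pi k u + Pi k v;
  proj_range : forall k, (k <= 3)%N -> Pi k @` D k `<=` L k;
  proj_onto : forall k, (k <= 3)%N -> forall v, L k v ->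
    exists2 w : pform R k, smooth_form Om w & Pi k (to_form Om w) = v;
  proj_id : forall k, (k <= 3)%N -> forall v, L k v -> Pi k v = v;
  proj_d : forall k, (k < 3)%N -> forall w : pform R k, smooth_form Om w ->
    dform (Pi k (to_form Om w)) = Pi k.+1 (to_form Om (ext_d w))
}.

Definition discrete_deRham_exact L : Prop :=
  exact_sequence (constants Om) (L 0) (L 1) (L 2) (L 3) dform dform dform.

End DiscreteSpaces.

(* V-valued k-forms are columns, and K-valued k-forms skew-symmetric matrices, of
   scalar k-forms; operators on scalar forms act on them through map_mx. *)
Section Elasticity.
Variables (R : realType) (Om : set (pt R)).

Definition Vform k : Type := 'cV[kform Om k]_3.
Definition Mform k : Type := 'M[kform Om k]_3.
HB.instance Definition _ k := GRing.Zmodule.on (Vform k).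
HB.instance Definition _ k := GRing.Zmodule.on (Mform k).

Definition Wform k : Type := (Mform k * Vform k)%type.
HB.instance Definition _ k := GRing.Zmodule.on (Wform k).

Definition skew_sym (V : zmodType) : set 'M[V]_3 := [set M | M^T = - M].

Definition skw (M : 'M[R]_3) : 'M[R]_3 := 2^-1 *: (M - M^T).

Definition Kx (x : pt R) (v : 'cV[R]_3) : 'M[R]_3 := 2 *: skw (vec x *m v^T).

Definition Kop k (w : Vform k) : Mform k := \matrix_(i, j) [ffun I =>
  cls Om (fun x => Kx x (\col_l repr (w l 0 I) x) i j)].

(* Lambda^k_h is L, tilde Lambda^k_h is Lt, and Pi projects onto L *)
Variables (L Lt : forall k, set (kform Om k)).
Variable Pi : forall k, kform Om k -> kform Om k.

Definition Vspace (A : forall k, set (kform Om k)) k : set (Vform k) :=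
  [set w | forall i, A k (w i 0)].

Definition Kspace (A : forall k, set (kform Om k)) k : set (Mform k) :=
  [set w | skew_sym w /\ forall i j, A k (w i j)].

Definition Wspace k : set (Wform k) :=
  [set w | Kspace L w.1 /\ Vspace Lt w.2].

Definition K_h k (w : Vform k) : Mform k := map_mx (@Pi k) (Kop w).

Definition S_h k (w : Vform k) : Mform k.+1 :=
  map_mx dform (K_h w) - K_h (map_mx dform w : Vform k.+1).

Definition A_h k (w : Wform k) : Wform k.+1 :=
  ((map_mx dform w.1 : Mform k.+1) - S_h w.2, map_mx dform w.2).

Definition PhiW : set (Wform 0) :=
  [set w | exists (om : 'M[R]_3) (mu : 'cV[R]_3), skew_sym om /\
     w = ((map_mx (const0 Om) om : Mform 0) + Kop (map_mx (const0 Om) mu),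
          map_mx (const0 Om) mu)].

Definition Gamma1 : set (Wform 1) :=
  [set w | Wspace w /\ map_mx dform w.1 = S_h w.2].

Definition Gamma2 : set (Wform 2) :=
  [set w | Wspace w /\ w.1 = 0].

End Elasticity.

Arguments Vform {R} Om k.
Arguments K_h {R Om} Pi k w.
Arguments S_h {R Om} Pi k w.
Arguments A_h {R Om} Pi k w.
Arguments Vspace {R Om} A k.
Arguments Kspace {R Om} A k.
Arguments Wspace {R Om} L Lt k.
Arguments PhiW {R} Om.

(* Main.v *)
(* S_h anticommutes with d, since d S_h = - d K_h d = - S_h d; hence A_h A_h = 0
   and the elasticity sequence is chased through the two de Rham sequences.  The
   surjectivity of S_(1,h) enters only at the last place: if d si0 = mu and
   om + S_h si0 = d (S_h rho), then si = si0 + d rho satisfies d si = mu and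
   - S_h si = om.  The sequences for K- and V-valued forms come from the scalar
   ones componentwise; a skew-symmetric preimage is obtained by taking the
   skew-symmetric part of an arbitrary one.  At the first place, K of a constant
   vector has components in P1, so Pi_h fixes it and K_h agrees there with K. *)
Require Import Defs.
From mathcomp Require Import all_boot all_order all_algebra.
From mathcomp Require Import all_classical all_reals all_analysis.

Set Implicit Arguments.
Unset Strict Implicit.
Unset Printing Implicit Defensive.

Import Order.TTheory GRing.Theory Num.Theory.
Import numFieldNormedType.Exports.

Local Open Scope classical_set_scope.
Local Open Scope ring_scope.

(** * Subgroups, and maps additive on a subgroup *)

Definition subgroup (U : zmodType) (A : set U) : Prop :=
  A 0 /\ forall u v, A u -> A v -> A (u - v).

(** Additivity is relative to [A] because [dform] and [Pi] are controlled only on part of their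
    domain types. On a subgroup, the identity for differences also yields those for zero, opposites
    and sums. *)
Definition additive_on (U V : zmodType) (A : set U) (f : U -> V) : Prop :=
  forall u v, A u -> A v -> f (u - v) = f u - f v.

Section AdditiveOn.
Variables (U V : zmodType) (A : set U) (f : U -> V).
Hypotheses (sA : subgroup A) (fA : additive_on A f).

Lemma subgroupN u : A u -> A (- u).
Proof. by move=> Au; rewrite -sub0r; apply: sA.2 => //; exact: sA.1. Qed.

Lemma subgroupD u v : A u -> A v -> A (u + v).
Proof. by move=> Au Av; rewrite -[v]opprK; apply: sA.2 => //; exact: subgroupN. Qed.

Lemma additive_on0 : f 0 = 0.
Proof. by rewrite -[0 in LHS](subrr 0) fA ?subrr//; exact: sA.1. Qed.

Lemma additive_onN u : A u -> f (- u) = - f u.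
Proof. by move=> Au; rewrite -sub0r fA ?additive_on0 ?sub0r//; exact: sA.1. Qed.

Lemma additive_onD u v : A u -> A v -> f (u + v) = f u + f v.
Proof.
move=> Au Av; rewrite -[v in LHS]opprK fA ?additive_onN ?opprK//.
exact: subgroupN.
Qed.

End AdditiveOn.

(** * The diagram chase for a complex twisted by [K], over abstract groups *)

Section TwistedComplex.
Variables (M V : nat -> zmodType).
Variables (A : forall k, set (M k)) (B : forall k, set (V k)).
Variables (dA : forall k, M k -> M k.+1) (dB : forall k, V k -> V k.+1).
Variable K : forall k, V k -> M k.

(** The abstract form of [S_h]: the commutator of d with [K]. *)
Definition twist k (mu : V k) : M k.+1 := dA (K mu) - K (dB mu).

Definition twisted_d k (w : M k * V k) : M k.+1 * V k.+1 :=
  (dA w.1 - twist w.2, dB w.2).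

Definition twisted_space k : set (M k * V k) := [set w | A w.1 /\ B w.2].

Variables (CA : set (M 0)) (CB : set (V 0)).
Hypothesis subA : forall k, (k <= 3)%N -> subgroup (@A k).
Hypothesis subB : forall k, (k <= 3)%N -> subgroup (@B k).
Hypothesis dA_add : forall k, (k < 3)%N -> additive_on (@A k) (@dA k).
Hypothesis dB_add : forall k, (k < 3)%N -> additive_on (@B k) (@dB k).
Hypothesis K_add : forall k, (k <= 3)%N -> additive_on (@B k) (@K k).
Hypothesis K_sub : forall k, (k <= 3)%N -> forall mu : V k, B mu -> A (K mu).
Hypothesis exA : exact_sequence CA (@A 0) (@A 1) (@A 2) (@A 3) (@dA 0) (@dA 1) (@dA 2).
Hypothesis exB : exact_sequence CB (@B 0) (@B 1) (@B 2) (@B 3) (@dB 0) (@dB 1) (@dB 2).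
Hypothesis twist1_onto : @twist 1 @` @B 1 = @A 2.

(** Stability under d, and d d = 0 below, are both read off from exactness: each image is part of a
    kernel, or is the whole last space. *)
Let dA_sub k : (k < 3)%N -> forall w : M k, A w -> A (dA w).
Proof.
case: exA => _ e1 e2 e3; case: k => [|[|[|//]]] _ w Aw.
- have : (@dA 0 @` @A 0) (dA w) by exists w.
  by rewrite e1 => -[].
- have : (@dA 1 @` @A 1) (dA w) by exists w.
  by rewrite e2 => -[].
- by rewrite -e3; exists w.
Qed.

Let dB_sub k : (k < 3)%N -> forall w : V k, B w -> B (dB w).
Proof.
case: exB => _ e1 e2 e3; case: k => [|[|[|//]]] _ w Bw.
- have : (@dB 0 @` @B 0) (dB w) by exists w.
  by rewrite e1 => -[].
- have : (@dB 1 @` @B 1) (dB w) by exists w.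
  by rewrite e2 => -[].
- by rewrite -e3; exists w.
Qed.

Let ddA k : (k < 2)%N -> forall w : M k, A w -> dA (dA w) = 0.
Proof.
case: exA => _ e1 e2 _; case: k => [|[|//]] _ w Aw.
- have : (@dA 0 @` @A 0) (dA w) by exists w.
  by rewrite e1 => -[].
- have : (@dA 1 @` @A 1) (dA w) by exists w.
  by rewrite e2 => -[].
Qed.

Let ddB k : (k < 2)%N -> forall w : V k, B w -> dB (dB w) = 0.
Proof.
case: exB => _ e1 e2 _; case: k => [|[|//]] _ w Bw.
- have : (@dB 0 @` @B 0) (dB w) by exists w.
  by rewrite e1 => -[].
- have : (@dB 1 @` @B 1) (dB w) by exists w.
  by rewrite e2 => -[].
Qed.

Let twist_sub k : (k < 3)%N -> forall mu : V k, B mu -> A (twist mu).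
Proof.
move=> k3 mu Bmu; apply: (subA k3).2; last by apply: K_sub => //; exact: dB_sub.
by apply: dA_sub => //; apply: K_sub => //; exact: ltnW.
Qed.

Let twist_add k : (k < 3)%N -> additive_on (@B k) (@twist k).
Proof.
move=> k3 u v Bu Bv; have k3' := ltnW k3; rewrite /twist K_add// dB_add// dA_add ?K_add//.
- by rewrite !opprD !opprK addrACA.
- exact: dB_sub.
- exact: dB_sub.
- exact: K_sub.
- exact: K_sub.
Qed.

Let d_twist k : (k < 2)%N -> forall mu : V k, B mu -> dA (twist mu) = - twist (dB mu).
Proof.
move=> k2 mu Bmu; have k3 : (k < 3)%N := ltnW k2; have k4 := ltnW k3.
have AK : A (K mu) by exact: K_sub.
have Bd : B (dB mu) by exact: dB_sub.
rewrite /twist dA_add ?ddA//; last 2 first.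
- exact: dA_sub.
- exact: K_sub.
by rewrite ddB// (additive_on0 (subB _) (K_add _))// subr0 sub0r.
Qed.

(** The first space is taken to be the kernel itself, so that place is immediate; an explicit
    description of this kernel depends on the concrete [K] and is left to the application. *)
Lemma twisted_exact :
  exact_sequence (@twisted_space 0 `&` [set w | twisted_d w = 0])
    (@twisted_space 0)
    (@twisted_space 1 `&` [set w | dA w.1 = twist w.2])
    (@twisted_space 2 `&` [set w | w.1 = 0])
    (@twisted_space 3)
    (@twisted_d 0) (@twisted_d 1) (@twisted_d 2).
Proof.
case: (exA) (exB) => _ a1 a2 a3 [_ b1 b2 b3].
split=> //; apply/seteqP; split.
(* The relation cutting out the second space holds on the image, since d (d eta - S nu) = - d S nu =
   S d nu. *)
- move=> _ [[eta nu] [/= Aeta Bnu] <-]; rewrite /twisted_d /=.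
  have At := twist_sub (k := 0) isT Bnu; have Bd := dB_sub (k := 0) isT Bnu.
  have dd : dA (dA eta - twist nu) = twist (dB nu).
    rewrite dA_add//; last exact: dA_sub.
    by rewrite ddA// d_twist// sub0r opprK.
  split; first by split=> //; split=> //=; apply: (subA (k := 1) isT).2 => //; exact: dA_sub.
  by rewrite /= dd subrr ddB.
(* Once d nu = mu, the form om + S nu is closed: d om = S mu = S d nu = - d S nu. A primitive eta of
   it completes nu. *)
- move=> [om mu] [[[/= Aom Bmu] dom] [_ dmu]].
  have [nu Bnu dnu] : (@dB 0 @` @B 0) mu by rewrite b1.
  have At := twist_sub (k := 0) isT Bnu.
  have [eta Aeta deta] : (@dA 0 @` @A 0) (om + twist nu).
    rewrite a1; split; first exact: subgroupD (subA _) _ _ _ _.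
    by rewrite /= (additive_onD (subA _) (dA_add _))// dom d_twist// dnu subrr.
  by exists (eta, nu); rewrite // /twisted_d /= deta dnu addrK.
(* The first component vanishes by the relation d om = S mu; the kernel condition is - S d mu = d S
   mu = d d om = 0. *)
- move=> _ [[om mu] [[/= Aom Bmu] dom] <-].
  have Bd := dB_sub (k := 1) isT Bmu.
  rewrite /twisted_d /= dom subrr; split; first by split=> //; split=> //=; exact: (subA _).1.
  rewrite /= ddB// (additive_on0 (subA _) (dA_add _))// sub0r.
  by rewrite -d_twist// -dom ddA.
(* Here S si = 0. With d mu = si, the form S mu is closed, and a primitive om of it satisfies
   exactly the relation d om = S mu. *)
- move=> [_ si] [[[_ /= Bsi] ->] [+ dsi]].
  rewrite /= (additive_on0 (subA _) (dA_add _))// sub0r => tsi.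
  have [mu Bmu dmu] : (@dB 1 @` @B 1) si by rewrite b2.
  have [om Aom dom] : (@dA 1 @` @A 1) (twist mu).
    rewrite a2; split; first exact: twist_sub.
    by rewrite /= d_twist// dmu.
  by exists (om, mu); rewrite // /twisted_d /= dom subrr dmu.
- move=> _ [[_ si] [[_ /= Bsi] ->] <-]; rewrite /twisted_d /=.
  split=> /=; last exact: dB_sub.
  apply: (subA _).2 => //; last exact: twist_sub.
  by apply: dA_sub => //; exact: (subA _).1.
- move=> [om mu] [/= Aom Bmu].
  have [si0 Bsi0 dsi0] : (@dB 2 @` @B 2) mu by rewrite b3.
  have [tau Atau dtau] : (@dA 2 @` @A 2) (om + twist si0).
    by rewrite a3; apply: subgroupD (subA _) _ _ _ _ => //; exact: twist_sub.
  have [rho Brho trho] : (@twist 1 @` @B 1) tau by rewrite twist1_onto.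
  have Bd := dB_sub (k := 1) isT Brho.
  (* The first component is forced to be 0, so [om] must be reached through the twist; adding
     [dB rho] does not change d of the second component. *)
  exists (0, si0 + dB rho).
    split=> //; split=> /=; first exact: (subA _).1.
    exact: subgroupD (subB _) _ _ _ _.
  rewrite /twisted_d /= (additive_on0 (subA _) (dA_add _))// sub0r.
  rewrite (additive_onD (subB _) (twist_add _))// (additive_onD (subB _) (dB_add _))//.
  rewrite ddB// addr0 dsi0; congr pair.
  by rewrite -[twist (dB rho)]opprK -d_twist// trho dtau opprB addrK.
Qed.

End TwistedComplex.

(** * Linearity of iterated partial derivatives on an open set *)

Section PartialDerivatives.
Variables (R : realType) (Om : set (pt R)).
Hypothesis oOm : open Om.

(** The identity for [h] is assumed on [Om] only; as [Om] is open it holds near [x], which is enough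
    for derivatives. The induction on iterated derivatives provides it in this form. *)
Lemma partial_comb (f g h : pt R -> R) (a : R) (j : 'I_3) (x : pt R) :
  Om x -> (forall y, Om y -> h y = a * f y + g y) ->
  derivable f x (basis3 R j) -> derivable g x (basis3 R j) ->
  derivable h x (basis3 R j) /\ partial j h x = a * partial j f x + partial j g x.
Proof.
move=> Omx hE df dg.
have near_h : \forall y \near x, (a \*: f + g) y = h y.
  by apply: filterS (open_nbhs_nbhs (conj oOm Omx)) => y Omy; rewrite hE.
have daf : derivable (a \*: f) x (basis3 R j) by exact: derivableZ.
split; first by apply: near_eq_derivable near_h _; exact: derivableD.
by rewrite /partial -(near_eq_derive _ near_h) deriveD// deriveZ.
Qed.

Lemma foldr_partial_comb (f g : pt R -> R) (a : R) (s : seq 'I_3) (x : pt R) :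
  smooth_on Om f -> smooth_on Om g -> Om x ->
  foldr (@partial R) (a *: f + g) s x =
    a * foldr (@partial R) f s x + foldr (@partial R) g s x.
Proof.
move=> sf sg; elim: s x => [|j s IH] x Omx //=.
have [_ df] := sf s x Omx; have [_ dg] := sg s x Omx.
by have [] := partial_comb Omx IH (df j) (dg j).
Qed.

Lemma smooth_on_comb (f g : pt R -> R) (a : R) :
  smooth_on Om f -> smooth_on Om g -> smooth_on Om (a *: f + g).
Proof.
move=> sf sg s x Omx; have [cf df] := sf s x Omx; have [cg dg] := sg s x Omx.
have hE y : Om y -> _ := @foldr_partial_comb f g a s y sf sg.
split=> [|j]; last by have [] := partial_comb Omx hE (df j) (dg j).
have near_h : \forall y \near x, a * foldr (@partial R) f s y + foldr (@partial R) g s y =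
    foldr (@partial R) (a *: f + g) s y.
  by apply: filterS (open_nbhs_nbhs (conj oOm Omx)) => y Omy; rewrite hE.
rewrite /prop_for /continuous_at hE//.
apply: cvg_trans (near_eq_cvg near_h) _.
by apply: cvgD => //; apply: cvgM => //; exact: cvg_cst.
Qed.

Lemma smooth_on0 : smooth_on Om (0 : pt R -> R).
Proof.
have f0 (s : seq 'I_3) : foldr (@partial R) 0 s = 0.
  by elim: s => //= j s ->; apply/funext => x; exact: derive_cst.
by move=> s x _; rewrite f0; split=> [|j]; [exact: cst_continuous|exact: derivable_cst].
Qed.

Lemma smooth_on_partial (f : pt R -> R) (j : 'I_3) :
  smooth_on Om f -> smooth_on Om (partial j f).
(* [foldr] applies the last index first, so the iterated derivatives of [partial j f] are those of
   [f] along sequences ending in [j]. *)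
Proof. by move=> sf s x Omx; rewrite -foldr_rcons; exact: sf. Qed.

Lemma smooth_on_sum (I : Type) (r : seq I) (P : pred I) (a : I -> R) (f : I -> pt R -> R) :
  (forall i, smooth_on Om (f i)) ->
  smooth_on Om (fun x => \sum_(i <- r | P i) a i * f i x).
Proof.
move=> sf; elim: r => [|i r IH].
  by under eq_fun do rewrite big_nil; exact: smooth_on0.
under eq_fun do rewrite big_cons; case: (P i) => //.
exact: (smooth_on_comb (a i)).
Qed.

End PartialDerivatives.

(** * Linearity of the exterior derivative on smooth forms *)

Section FormOperations.
Variables (R : realType) (Om : set (pt R)).

Lemma eq_cls (f g : pt R -> R) : (forall x, Om x -> f x = g x) -> cls Om f = cls Om g.
Proof. by move=> fg; apply/clsP; exact: aeW. Qed.

Lemma cls_comb (a : R) (f g : pt R -> R) :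
  cls Om (a *: f + g) = a *: cls Om f + cls Om g.
Proof. by rewrite clsD -cls_scale. Qed.

Lemma to_form_comb k (a : R) (u v : pform R k) :
  to_form Om (fun I => a *: u I + v I) = a *: to_form Om u + to_form Om v.
Proof. by apply/ffunP => I; rewrite !ffunE cls_comb. Qed.

Lemma pcoef_comb k (a : R) (u v : pform R k) J :
  pcoef (fun I => a *: u I + v I) J = a *: pcoef u J + pcoef v J.
Proof.
(* When [J] does not have [k] elements, every coefficient is the default 0. *)
rewrite /pcoef; case: insubP => [I _ _|_] //=.
by apply/funext => x; change (0 = a * 0 + 0 :> R); rewrite mulr0 addr0.
Qed.

Lemma smooth_pcoef k (u : pform R k) J : smooth_form Om u -> smooth_on Om (pcoef u J).
Proof.
by move=> su; rewrite /pcoef; case: insubP => [I _ _|_] /=; [exact: su|exact: smooth_on0].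
Qed.

Lemma smooth_ext_d k (u : pform R k) : open Om ->
  smooth_form Om u -> smooth_form Om (ext_d u).
Proof.
move=> oOm su J; rewrite /ext_d; apply: smooth_on_sum => // j.
by apply: smooth_on_partial; exact: smooth_pcoef.
Qed.

(** The equality is between classes: the partial derivatives are compared only at points of [Om]. *)
Lemma ext_d_comb k (a : R) (u v : pform R k) : open Om ->
  smooth_form Om u -> smooth_form Om v ->
  to_form Om (ext_d (fun I => a *: u I + v I)) =
    a *: to_form Om (ext_d u) + to_form Om (ext_d v).
Proof.
move=> oOm su sv; rewrite -to_form_comb; apply/ffunP => J; rewrite !ffunE.
apply: eq_cls => x Omx.
have -> : (a *: ext_d u J + ext_d v J) x = a * ext_d u J x + ext_d v J x by [].
rewrite /ext_d mulr_sumr -big_split /=; apply: eq_bigr => j _.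
have hE y : Om y -> pcoef (fun I => a *: u I + v I) (val J :\ j) y =
    a * pcoef u (val J :\ j) y + pcoef v (val J :\ j) y.
  by rewrite pcoef_comb.
(* The empty sequence of derivatives gives derivability of the coefficient itself. *)
have [_ du] := smooth_pcoef (val J :\ j) su [::] Omx.
have [_ dv] := smooth_pcoef (val J :\ j) sv [::] Omx.
have [_ ->] := partial_comb oOm Omx hE (du j) (dv j).
by rewrite mulrDr mulrCA.
Qed.

End FormOperations.

(** * Linear subspaces and maps linear on them *)

Definition linear_on (R : realType) (U V : lmodType R) (A : set U) (f : U -> V) : Prop :=
  forall (a : R) (u v : U), A u -> A v -> f (a *: u + v) = a *: f u + f v.

Section LinearOn.
Variables (R : realType) (U V : lmodType R) (A : set U) (f : U -> V).

Lemma findim_lin_subspace : findim_subspace A -> lin_subspace A.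
Proof.
case=> n [b ->]; split.
  by exists (fun=> 0); rewrite big1// => i _; rewrite scale0r.
move=> a _ _ [c ->] [e ->]; exists (fun i => a * c i + e i).
rewrite scaler_sumr -big_split; apply: eq_bigr => i _.
by rewrite scalerDl scalerA.
Qed.

Lemma lin_subspace_subgroup : lin_subspace A -> subgroup A.
Proof.
case=> A0 AD; split=> // u v Au Av.
by rewrite addrC -scaleN1r; exact: AD.
Qed.

Lemma lin_subspaceZ (a : R) u : lin_subspace A -> A u -> A (a *: u).
Proof. by case=> A0 AD Au; rewrite -[a *: u]addr0; exact: AD. Qed.

Hypothesis fA : linear_on A f.

Lemma linear_on_additive : additive_on A f.
Proof. by move=> u v Au Av; rewrite addrC -scaleN1r fA// scaleN1r addrC. Qed.

Lemma linear_onZ (a : R) u : lin_subspace A -> A u -> f (a *: u) = a *: f u.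
Proof.
move=> sA Au; have sA' := lin_subspace_subgroup sA.
rewrite -[a *: u in LHS]addr0 fA//; last exact: sA.1.
by rewrite (additive_on0 sA' linear_on_additive) addr0.
Qed.

End LinearOn.

(* Weak derivatives need not be compared here: a discrete form is the projection
   of a smooth one, and proj_d gives the value of dform on it. *)
Lemma dform_linear_on (R : realType) (Om : set (pt R))
    (L D : forall k, set (kform Om k)) (Pi : forall k, kform Om k -> kform Om k) :
  open Om -> projections L D Pi ->
  forall k, (k < 3)%N -> linear_on (L k) (@dform R Om k).
Proof.
move=> oOm hPi k k3 a u v Lu Lv; have k3' := ltnW k3.
have [wu su <-] := proj_onto hPi k3' Lu; have [wv sv <-] := proj_onto hPi k3' Lv.
have suv : smooth_form Om (fun I => a *: wu I + wv I).
  by move=> I; apply: smooth_on_comb.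
have Du := proj_dom_smooth hPi k3' su; have Dv := proj_dom_smooth hPi k3' sv.
(* The combination is moved inside [Pi], exchanged with d there, and split by linearity of [ext_d]
   on smooth forms. *)
rewrite -(proj_linear hPi)// -to_form_comb !(proj_d hPi)// ext_d_comb//.
by rewrite (proj_linear hPi)//; apply: (proj_dom_smooth hPi) => //; exact: smooth_ext_d.
Qed.

(** * From scalar exact sequences to columns and skew-symmetric matrices *)

Section ComponentwiseExactness.

(** [Kspace] and [Vspace] are instances of this and of [col_over] up to conversion; an arbitrary [A]
    allows kernels, images and constants as well. *)
Definition skew_mx_over (U : zmodType) (A : set U) : set 'M[U]_3 :=
  [set w | skew_sym w /\ forall i j, A (w i j)].

Definition col_over (U : zmodType) (A : set U) : set 'cV[U]_3 :=
  [set w | forall i, A (w i 0)].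

Lemma image_col_over (U V : zmodType) (A : set U) (f : U -> V) :
  map_mx f @` col_over A = col_over (f @` A).
Proof.
apply/seteqP; split=> [_ [w Aw <-] i|w fAw].
  by exists (w i 0); rewrite ?mxE//; exact: Aw.
have /choice[u uP] : forall i : 'I_3, exists u, A u /\ f u = w i 0.
  by move=> i; have [u Au fu] := fAw i; exists u.
exists (\col_i u i); first by move=> i; rewrite mxE; have [] := uP i.
by apply/matrixP => i j; rewrite !mxE ord1; have [] := uP i.
Qed.

(** Preimages chosen entry by entry need not form a skew-symmetric matrix. Taking the skew part
    involves the factor 1/2, whence linearity over [R] instead of additivity. *)
Lemma image_skew_mx_over (R : realType) (U V : lmodType R) (A : set U) (f : U -> V) :
  lin_subspace A -> linear_on A f ->
  map_mx f @` skew_mx_over A = skew_mx_over (f @` A).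
Proof.
move=> lA fA; have sA := lin_subspace_subgroup lA.
have aA := linear_on_additive fA.
have fN u : A u -> f (- u) = - f u by move=> Au; rewrite (additive_onN sA aA).
apply/seteqP; split=> [_ [w [skw_w Aw] <-]|w [skw_w fAw]].
  split=> [|i j]; last by exists (w i j); rewrite ?mxE.
  by apply/matrixP => i j; have /matrixP/(_ i j) := skw_w; rewrite !mxE => ->; rewrite fN.
have /choice[u uP] : forall ij : 'I_3 * 'I_3, exists u, A u /\ f u = w ij.1 ij.2.
  by move=> -[i j]; have [u Au fu] := fAw i j; exists u.
have uA i j : A (u (i, j)) by have [] := uP (i, j).
have fu i j : f (u (i, j)) = w i j by have [] := uP (i, j).
have uB i j : A (u (i, j) - u (j, i)) by exact: sA.2.
exists (\matrix_(i, j) (2^-1 *: (u (i, j) - u (j, i)))).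
  split=> [|i j]; last by rewrite mxE; exact: lin_subspaceZ.
  by apply/matrixP => i j; rewrite !mxE -scalerN opprB.
apply/matrixP => i j; rewrite !mxE (linear_onZ fA)// (linear_on_additive fA)// !fu.
have /matrixP/(_ i j) := skw_w; rewrite !mxE => ->.
by rewrite opprK -mulr2n -scalerMnr scalerMnl -mulr_natr mulVf ?scale1r// pnatr_eq0.
Qed.

Lemma skew_mx_over_setI_ker (U V : zmodType) (A : set U) (f : U -> V) :
  skew_mx_over (A `&` [set v | f v = 0]) =
    skew_mx_over A `&` [set v | map_mx f v = 0].
Proof.
apply/seteqP; split=> [w [sw Aw]|w [[sw Aw] /matrixP fw]].
  split; first by split=> // i j; have [] := Aw i j.
  by apply/matrixP => i j; rewrite !mxE; have [] := Aw i j.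
by split=> // i j; split=> //; have := fw i j; rewrite !mxE.
Qed.

Lemma col_over_setI_ker (U V : zmodType) (A : set U) (f : U -> V) :
  col_over (A `&` [set v | f v = 0]) = col_over A `&` [set v | map_mx f v = 0].
Proof.
apply/seteqP; split=> [w Aw|w [Aw /matrixP fw] i].
  split; first by move=> i; have [] := Aw i.
  by apply/matrixP => i j; rewrite !mxE ord1; have [] := Aw i.
by split=> //; have := fw i 0; rewrite !mxE.
Qed.

Lemma exact_col_over (V0 V1 V2 V3 : zmodType)
    (C A0 : set V0) (A1 : set V1) (A2 : set V2) (A3 : set V3)
    (f0 : V0 -> V1) (f1 : V1 -> V2) (f2 : V2 -> V3) :
  exact_sequence C A0 A1 A2 A3 f0 f1 f2 ->
  exact_sequence (col_over C) (col_over A0) (col_over A1) (col_over A2) (col_over A3)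
    (map_mx f0) (map_mx f1) (map_mx f2).
Proof.
case=> -> e1 e2 e3; split; first exact: col_over_setI_ker.
- by rewrite image_col_over e1 col_over_setI_ker.
- by rewrite image_col_over e2 col_over_setI_ker.
- by rewrite image_col_over e3.
Qed.

Lemma exact_skew_mx_over (R : realType) (V0 V1 V2 V3 : lmodType R)
    (C A0 : set V0) (A1 : set V1) (A2 : set V2) (A3 : set V3)
    (f0 : V0 -> V1) (f1 : V1 -> V2) (f2 : V2 -> V3) :
  lin_subspace A0 -> lin_subspace A1 -> lin_subspace A2 ->
  linear_on A0 f0 -> linear_on A1 f1 -> linear_on A2 f2 ->
  exact_sequence C A0 A1 A2 A3 f0 f1 f2 ->
  exact_sequence (skew_mx_over C) (skew_mx_over A0) (skew_mx_over A1)
    (skew_mx_over A2) (skew_mx_over A3) (map_mx f0) (map_mx f1) (map_mx f2).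
Proof.
move=> A0l A1l A2l f0l f1l f2l [-> e1 e2 e3].
split; first exact: skew_mx_over_setI_ker.
- by rewrite image_skew_mx_over// e1 skew_mx_over_setI_ker.
- by rewrite image_skew_mx_over// e2 skew_mx_over_setI_ker.
- by rewrite image_skew_mx_over// e3.
Qed.

Lemma subgroup_col_over (U : zmodType) (A : set U) : subgroup A -> subgroup (col_over A).
Proof.
by move=> sA; split=> [i|u v Au Av i]; rewrite !mxE; [exact: sA.1|exact: sA.2].
Qed.

Lemma subgroup_skew_mx_over (U : zmodType) (A : set U) :
  subgroup A -> subgroup (skew_mx_over A).
Proof.
move=> sA; split=> [|u v [su Au] [sv Av]].
  by split=> [|i j]; [rewrite /skew_sym /= trmx0 oppr0|rewrite mxE; exact: sA.1].
split=> [|i j]; last by rewrite !mxE; exact: sA.2.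
apply/matrixP => i j; move/matrixP/(_ i j): su; move/matrixP/(_ i j): sv.
by rewrite !mxE => -> ->; rewrite opprB opprK addrC.
Qed.

Lemma additive_on_col_over (U V : zmodType) (A : set U) (f : U -> V) :
  additive_on A f -> additive_on (col_over A) (map_mx f).
Proof. by move=> fA u v Au Av; apply/matrixP => i j; rewrite !mxE fA// ord1. Qed.

Lemma additive_on_skew_mx_over (U V : zmodType) (A : set U) (f : U -> V) :
  additive_on A f -> additive_on (skew_mx_over A) (map_mx f).
Proof. by move=> fA u v [_ Au] [_ Av]; apply/matrixP => i j; rewrite !mxE fA. Qed.

End ComponentwiseExactness.

(** * The operator [K] in coordinates *)

Section Koperator.
Variables (R : realType) (Om : set (pt R)).

(** Computed on a chosen representative; [mulL0_cls] shows that the choice does not matter. *)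
Definition mulL0 (m : pt R -> R) (w : L0 Om) : L0 Om := cls Om (fun x => m x * repr w x).

Lemma mulL0_cls m f : mulL0 m (cls Om f) = cls Om (fun x => m x * f x).
Proof.
by apply/clsP; have := repr_cls Om f; apply: filterS => x fx Omx; rewrite /= fx.
Qed.

Lemma clsB f g : cls Om (f - g) = cls Om f - cls Om g.
Proof. by rewrite addrC -scaleN1r cls_comb scaleN1r addrC. Qed.

Lemma mulL0B m u v : mulL0 m (u - v) = mulL0 m u - mulL0 m v.
Proof.
rewrite -[u]clsK -[v]clsK -clsB !mulL0_cls -clsB; apply: eq_cls => x _.
by rewrite /= mulrBr.
Qed.

(** The factor 2 in [Kx] cancels the 1/2 in [skw], leaving x v^T - v x^T. *)
Lemma KxE (x : pt R) (v : 'I_3 -> R) i j :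
  Kx x (\col_l v l) i j = vec x i 0 * v j - vec x j 0 * v i.
Proof.
rewrite /Kx /skw scalerA mulfV ?pnatr_eq0// scale1r !mxE.
by rewrite !big_ord1 !mxE.
Qed.

Lemma KopE k (w : Vform Om k) i j I :
  Kop w i j I = mulL0 (fun x => vec x i 0) (w j 0 I) - mulL0 (fun x => vec x j 0) (w i 0 I).
Proof.
by rewrite mxE ffunE -clsB; apply: eq_cls => x _; rewrite KxE.
Qed.

Lemma KopB k (u v : Vform Om k) : Kop (u - v) = Kop u - Kop v.
Proof.
apply/matrixP => i j; apply/ffunP => I.
have -> : (Kop u - Kop v) i j I = Kop u i j I - Kop v i j I by rewrite !mxE !ffunE.
by rewrite !KopE !mxE !ffunE !mulL0B !opprD !opprK addrACA.
Qed.

Lemma Kop_skew k (w : Vform Om k) i j : Kop w j i = - Kop w i j.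
Proof. by apply/ffunP => I; rewrite ffunE !KopE opprB. Qed.

Lemma Kop_const_P1 (mu : 'cV[R]_3) i j : P1 Om (Kop (map_mx (const0 Om) mu) i j).
Proof.
(* The entry is x_i mu_j - x_j mu_i: no constant term, and gradient mu_j e_i - mu_i e_j. *)
exists 0, (mu j 0 *: delta_mx 0 i - mu i 0 *: delta_mx 0 j).
apply/ffunP => I; rewrite KopE !mxE !ffunE !mulL0_cls -clsB.
apply: eq_cls => x _; transitivity (vec x i 0 * mu j 0 - vec x j 0 * mu i 0) => //.
rewrite mulmxBl -!scalemxAl -!rowE add0r; move: (vec x) => X; rewrite !mxE.
by rewrite mulrC [X j 0 * _]mulrC.
Qed.

End Koperator.

(** * The discrete operator [K_h] *)

Section DiscreteOperators.
Variables (R : realType) (Om : set (pt R)).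
Variables (L Lt D : forall k, set (kform Om k)).
Variable Pi : forall k, kform Om k -> kform Om k.
Hypothesis hPi : projections L D Pi.
Hypothesis hDK : forall k, (k <= 3)%N -> forall w : Vform Om k, Vspace Lt k w ->
  forall i j, @D k (Kop w i j).

Lemma K_h_additive k : (k <= 3)%N -> additive_on (Vspace Lt k) (K_h Pi k).
Proof.
move=> k3 u v Bu Bv; rewrite /K_h KopB; apply/matrixP => i j.
have := linear_on_additive (proj_linear hPi k3) (hDK k3 Bu i j) (hDK k3 Bv i j).
have E (M : Mform Om k) : map_mx (@Pi k) M i j = Pi (M i j) by rewrite mxE.
by move=> PiB; rewrite E mxE [X in Pi (_ + X)]mxE PiB [RHS]mxE [X in _ = _ + X]mxE !E.
Qed.

(** Skew-symmetry survives the projection because [Pi] is odd on [D k], which contains the entries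
    of K mu by [hDK]. *)
Lemma K_h_Kspace k (mu : Vform Om k) :
  (k <= 3)%N -> Vspace Lt k mu -> Kspace L k (K_h Pi k mu).
Proof.
move=> k3 Bmu; have DK := hDK k3 Bmu.
have E a b : K_h Pi k mu a b = Pi (Kop mu a b) by rewrite /K_h mxE.
split=> [|i j]; last by rewrite E; apply: (proj_range hPi) => //; exists (Kop mu i j).
apply/matrixP => i j; rewrite mxE [RHS]mxE !E Kop_skew.
by rewrite (additive_onN (lin_subspace_subgroup (proj_dom hPi k3))
  (linear_on_additive (proj_linear hPi k3))).
Qed.

End DiscreteOperators.

(** * Constant forms, and the elasticity sequence *)

Lemma const0Z (R : realType) (Om : set (pt R)) (a b : R) :
  const0 Om (a * b) = a *: const0 Om b.
Proof. by apply/ffunP => I; rewrite !ffunE -cls_scale. Qed.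

Lemma const0N (R : realType) (Om : set (pt R)) (a : R) : const0 Om (- a) = - const0 Om a.
Proof. by rewrite -mulN1r const0Z scaleN1r. Qed.

Lemma const0D (R : realType) (Om : set (pt R)) (a b : R) :
  const0 Om (a + b) = const0 Om a + const0 Om b.
Proof. by apply/ffunP => I; rewrite !ffunE -clsD. Qed.

Lemma skw_skew_sym (R : realType) (M : 'M[R]_3) : skew_sym (skw M).
Proof. by apply/matrixP => i j; rewrite !mxE -mulrN opprB. Qed.

(** [PhiW] asks for a skew-symmetric real matrix, while exactness gives skew-symmetry of the matrix
    of constant forms; passing to [skw M] supplies the former and keeps the forms. *)
Lemma const0_skw (R : realType) (Om : set (pt R)) (M : 'M[R]_3) :
  skew_sym (map_mx (const0 Om) M) -> map_mx (const0 Om) (skw M) = map_mx (const0 Om) M.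
Proof.
move=> skM; apply/matrixP => i j; have /matrixP/(_ j i) := skM; rewrite !mxE => E.
rewrite const0Z const0D const0N -E -mulr2n.
by rewrite -scalerMnr scalerMnl -mulr_natr mulVf ?scale1r// pnatr_eq0.
Qed.

Theorem theorem5p1 (R : realType) (Om : set (pt R)) (hOm : domain3 Om)
  (L Lt : forall k, set (kform Om k))
  (hL : discrete_spaces L) (hLt : discrete_spaces Lt)
  (D Dt : forall k, set (kform Om k))
  (Pi Pit : forall k, kform Om k -> kform Om k)
  (hPi : projections L D Pi) (hPit : projections Lt Dt Pit)
  (* Pi^k is also defined, componentwise, on K tilde Lambda^k_h(V) *)
  (hDK : forall k, (k <= 3)%N -> forall w : Vform Om k, Vspace Lt k w ->
     forall i j, D k (Kop w i j))
  (hP1 : P1 Om `<=` L 0) (hP1t : P1 Om `<=` Lt 0)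
  (hS : S_h Pi 1 @` Vspace Lt 1 = Kspace L 2)
  (hex : discrete_deRham_exact L) (hext : discrete_deRham_exact Lt) :
  exact_sequence (PhiW Om)
    (Wspace L Lt 0) (Gamma1 L Lt Pi) (Gamma2 L Lt)
    (Wspace L Lt 3)
    (A_h Pi 0) (A_h Pi 1) (A_h Pi 2).
Proof.
have oOm : open Om by case: hOm.
have dL := dform_linear_on oOm hPi; have dLt := dform_linear_on oOm hPit.
have lL k : (k <= 3)%N -> lin_subspace (L k).
  by case: hL => fd _ _ k3; exact/findim_lin_subspace/fd.
have lLt k : (k <= 3)%N -> lin_subspace (Lt k).
  by case: hLt => fd _ _ k3; exact/findim_lin_subspace/fd.
have subA k (k3 : (k <= 3)%N) : subgroup (Kspace L k) :=
  subgroup_skew_mx_over (lin_subspace_subgroup (lL k k3)).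
have subB k (k3 : (k <= 3)%N) : subgroup (Vspace Lt k) :=
  subgroup_col_over (lin_subspace_subgroup (lLt k k3)).
have dA_add k (k3 : (k < 3)%N) :
    additive_on (Kspace L k) (map_mx (@dform R Om k) : Mform Om k -> Mform Om k.+1) :=
  additive_on_skew_mx_over (linear_on_additive (dL k k3)).
have dB_add k (k3 : (k < 3)%N) :
    additive_on (Vspace Lt k) (map_mx (@dform R Om k) : Vform Om k -> Vform Om k.+1) :=
  additive_on_col_over (linear_on_additive (dLt k k3)).
have K_add := K_h_additive hPi hDK.
have K_sub := K_h_Kspace hPi hDK.
have exA := exact_skew_mx_over (lL 0 isT) (lL 1 isT) (lL 2 isT)
  (dL 0 isT) (dL 1 isT) (dL 2 isT) hex.
have exB := exact_col_over hext.
(* The kernel at the first place is identified with the explicit space. *)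
have PhiWE : PhiW Om = Wspace L Lt 0 `&` [set w | A_h Pi 0 w = 0].
  have [CA _ _ _] := exA; have [CB _ _ _] := exB.
  have kerB m : Vspace Lt 0 (map_mx (const0 Om) m) /\
      map_mx (@dform R Om 0) (map_mx (const0 Om) m : Vform Om 0) = 0.
    suff : col_over (constants Om) (map_mx (const0 Om) m) by rewrite CB.
    by move=> i; rewrite mxE; exists (m i 0).
  have KpL m : Kspace L 0 (Kop (map_mx (const0 Om) m)).
    split=> [|i j]; last exact/hP1/Kop_const_P1.
    by apply/matrixP => i j; rewrite mxE [RHS]mxE Kop_skew.
  (* On a constant m the term K_h d m vanishes, and [Pi] fixes K m since its entries are in [P1];
     hence S_h m = d K m. *)
  have Sp m : S_h Pi 0 (map_mx (const0 Om) m) =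
      map_mx (@dform R Om 0) (Kop (map_mx (const0 Om) m)).
    have [_ dm] := kerB m; rewrite /S_h dm (additive_on0 (subB 1 isT) (K_add 1 isT)) subr0.
    congr map_mx; apply/matrixP => i j; rewrite /K_h mxE.
    by rewrite (proj_id hPi)//; exact/hP1/Kop_const_P1.
  apply/seteqP; split=> [_ [c [m [skc ->]]]|[om mu] [[/= Aom Bmu]]].
    have [Bm dm] := kerB m.
    have [Ac dc] : Kspace L 0 (map_mx (const0 Om) c) /\
        map_mx (@dform R Om 0) (map_mx (const0 Om) c : Mform Om 0) = 0.
      suff : skew_mx_over (constants Om) (map_mx (const0 Om) c) by rewrite CA.
      split=> [|i j]; last by rewrite mxE; exists (c i j).
      by apply/matrixP => i j; have /matrixP/(_ i j) := skc; rewrite !mxE => ->; rewrite const0N.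
    split; first by split=> //=; exact: subgroupD (subA 0 isT) _ _ _ _.
    by rewrite /A_h /= Sp dm (additive_onD (subA 0 isT) (dA_add 0 isT))// dc add0r subrr.
  (* Conversely, d mu = 0 makes mu a constant m, so that d om = S_h m = d K m; then om - K m is
     closed and skew-symmetric, hence constant. *)
  rewrite /A_h /= => -[/subr0_eq dom dmu].
  have [m mE] : exists m, mu = map_mx (const0 Om) m.
    have muC : col_over (constants Om) mu by rewrite CB.
    have /choice[f fP] : forall i, exists a, const0 Om a = mu i 0.
      by move=> i; have [a _ aE] := muC i; exists a.
    by exists (\col_i f i); apply/matrixP => i j; rewrite !mxE ord1 fP.
  subst mu; rewrite Sp in dom.
  have [skc cE] : skew_mx_over (constants Om) (om - Kop (map_mx (const0 Om) m)).
    rewrite CA; split; first exact: (subA 0 isT).2.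
    by rewrite /= (dA_add 0 isT)// dom subrr.
  have [c cM] : exists c, map_mx (const0 Om) c = om - Kop (map_mx (const0 Om) m).
    have /choice[f fP] : forall ij : 'I_3 * 'I_3, exists a,
        const0 Om a = (om - Kop (map_mx (const0 Om) m)) ij.1 ij.2.
      by move=> ij; have [a _ aE] := cE ij.1 ij.2; exists a.
    by exists (\matrix_(i, j) f (i, j)); apply/matrixP => i j; rewrite mxE mxE fP.
  exists (skw c), m; split; last by rewrite const0_skw cM ?subrK.
  exact: skw_skew_sym.
rewrite PhiWE.
(* With [K_h] for [K], [twist] unfolds to [S_h] and [twisted_d] to [A_h], so the abstract sequence
   is the elasticity sequence up to conversion. *)
exact: (@twisted_exact (Mform Om) (Vform Om) (Kspace L) (Vspace Lt)
  (fun k => map_mx (@dform R Om k)) (fun k => map_mx (@dform R Om k)) (K_h Pi)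
  _ _ subA subB dA_add dB_add K_add (fun k k3 mu => K_sub k mu k3) exA exB hS).
Qed.
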